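(* Let $T$ be an operator semigroup on a set $D$ with $\operatorname{Id}\in T$, let $S$ be a $T$-space, and let a map $\Phi:T\times S\to S$ be given by $(f,x)\mapsto f(x)$. Then $\Phi$ is well-defined and $(T,S,\Phi)$ is a dynamical system.
   Context: An operator semigroup on a set $D$ is a set $T$ of functions $D\to D$ closed under composition; a $T$-space is a subset of $D$ of the form $\langle U\rangle_T=\{f(u):f\in T,u\in U\}$ with $U\subseteq D$. A dynamical system is a triple $(M,S,\Phi)$ where $M$ is a monoid with identity $e$, $S$ is a set, and $\Phi:M\times S\to S$, $(g,x)\mapsto\Phi_g(x)$, is a map such that $\Phi_g\circ\Phi_h=\Phi_{g\circ h}$ for all $g,h\in M$ (where $g\circ h$ is the product in $M$) and $\Phi_e=\operatorname{Id}$. Here $T$ is regarded as a monoid under composition with identity element $\operatorname{Id}$ (the identity function on $D$). *)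

(* Defs.v *)
From mathcomp Require Import all_boot.
From mathcomp Require Import boolp classical_sets functions.

Set Implicit Arguments.
Unset Strict Implicit.
Unset Printing Implicit Defensive.

Local Open Scope classical_set_scope.

Definition operator_semigroup (D : Type) (T : set (D -> D)) : Prop :=
  forall f g, T f -> T g -> T (f \o g).

Definition generated (D : Type) (T : set (D -> D)) (U : set D) : set D :=
  [set f u | f in T & u in U].

Definition is_Tspace (D : Type) (T : set (D -> D)) (S : set D) : Prop :=
  exists U : set D, S = generated T U.

(* The triple (M, S, Phi), with the monoid M given by its carrier, its product
   [op] and its identity [e]; the first three clauses are the monoid axioms.
   [monoidType] is not used because it would require a choice structure
   on M. *)
Definition dynamical_system (M S : Type) (op : M -> M -> M) (e : M)
    (Phi : M * S -> S) : Prop :=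
  let Phi_ g := fun x => Phi (g, x) in
  [/\ associative op, left_id e op, right_id e op,
      forall g h, Phi_ g \o Phi_ h = Phi_ (op g h)
    & Phi_ e = idfun].

Definition semigroup_comp (D : Type) (T : set (D -> D))
    (hT : operator_semigroup T) (f g : T) : T :=
  exist _ (\val f \o \val g)
    (mem_set (hT _ _ (set_mem (valP f)) (set_mem (valP g)))).

Definition semigroup_id (D : Type) (T : set (D -> D)) (hId : T idfun) : T :=
  exist _ idfun (mem_set hId).

Definition eval_pair (D : Type) (p : (D -> D) * D) : D := p.1 p.2.

(* Forming the map T * S -> S, (f, x) |-> f x, requires the proof [wd] that
   its values lie in S. *)
Definition evaluation (D : Type) (T : set (D -> D)) (S : set D)
    (wd : set_fun (T `*` S) S (@eval_pair D)) (p : T * S) : S :=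
  exist _ (eval_pair (\val p.1, \val p.2))
    (mem_set (wd (\val p.1, \val p.2)
       (conj (set_mem (valP p.1)) (set_mem (valP p.2))))).

(* Main.v *)
Require Import Defs.
From mathcomp Require Import all_boot.
From mathcomp Require Import boolp classical_sets functions.

(** The only point with content is that evaluation stays inside [S]: an element
    of a T-space has the form [f u] with [f] in [T] and [u] a generator, so
    [g (f u) = (g \o f) u] is again of this form because [T] is closed under
    composition.  The monoid and action laws are then those of composition and
    evaluation of functions, transported along the injective projections from
    [T] and [S] to the ambient types. *)

Local Open Scope classical_set_scope.

Lemma Tspace_stable (D : Type) (T : set (D -> D)) (S : set D) :
  operator_semigroup T -> is_Tspace T S ->
  set_fun (T `*` S) S (@eval_pair D).
Proof.
move=> hT [U ->] [g _] [/= Tg [f Tf [u Uu <-]]].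
by exists (g \o f); [exact: hT | exists u].
Qed.

Theorem proposition24p1p3 (D : Type) (T : set (D -> D))
    (hT : operator_semigroup T) (hId : T idfun)
    (S : set D) (hS : is_Tspace T S) :
  exists wd : set_fun (T `*` S) S (@eval_pair D),
    dynamical_system (semigroup_comp hT) (semigroup_id hId) (evaluation wd).
Proof.
exists (@Tspace_stable D T S hT hS); split.
- by move=> f g h; apply: val_inj.
- by move=> f; apply: val_inj.
- by move=> f; apply: val_inj.
- by move=> g h; apply: funext => x; apply: val_inj.
- by apply: funext => x; apply: val_inj.
Qed.
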